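(* For any fixed $n\ge 1$, the sequences $$\ell_{n,1}^{\mathrm{2row}},\ \ell_{n,2}^{\mathrm{2row}},\dots,\ell_{n,n}^{\mathrm{2row}}\quad\text{and}\quad i_{n,1}^{\mathrm{2row}},\ i_{n,2}^{\mathrm{2row}},\dots,i_{n,n}^{\mathrm{2row}}$$ are log concave.
   Context: $\mathfrak S_n$ is the set of permutations of $[n]=\{1,\dots,n\}$. For $\pi\in\mathfrak S_n$, $\ell(\pi)$ is the length of a longest increasing subsequence of $\pi$ (in one-line notation). The shape $\operatorname{sh}\pi$ is the common shape (a partition of $n$) of the two standard Young tableaux associated with $\pi$ by the Robinson–Schensted correspondence. Let $\mathrm{2row}$ be the set of all partitions of $n$ with at most two rows, i.e. those of the form $(k,n-k)$ with $n/2\le k\le n$ (for $k=n$ this is the one-row partition $(n)$). Then $\ell_{n,k}^{\mathrm{2row}}$ is the number of $\pi\in\mathfrak S_n$ with $\ell(\pi)=k$ and $\operatorname{sh}\pi\in\mathrm{2row}$, and $i_{n,k}^{\mathrm{2row}}$ is the number of involutions $\pi\in\mathfrak S_n$ (permutations whose square is the identity) with $\ell(\pi)=k$ and $\operatorname{sh}\pi\in\mathrm{2row}$. (These numbers are $0$ for $k<n/2$.) A sequence of real numbers $l_1,\dots,l_n$ is log concave if $l_{k-1}l_{k+1}\le l_k^2$ for all $1\le k\le n$, with the convention $l_0=l_{n+1}=0$. *)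

(* Defs.v *)
From mathcomp Require Import all_boot all_order all_algebra all_fingroup.
Set Implicit Arguments.
Unset Strict Implicit.
Unset Printing Implicit Defensive.
Import Order.TTheory GRing.Theory Num.Theory.

(* One-line notation, with 'I_n = {0, ..., n-1} shifted to {1, ..., n}. *)
Definition one_line (n : nat) (s : 'S_n) : seq nat :=
  [seq (val (s i)).+1 | i <- enum 'I_n].

Definition longest_inc (w : seq nat) : nat :=
  \max_(m : (size w).-tuple bool | sorted ltn (mask m w)) size (mask m w).

(* Schensted insertion of x into an increasing row: x replaces the leftmost
   entry larger than it, which is returned as bumped; failing that, x is
   appended to the row and nothing is bumped. *)
Fixpoint row_insert (x : nat) (r : seq nat) : option nat * seq nat :=
  if r is y :: r' then
    if x < y then (Some y, x :: r')
    else let: (b, r'') := row_insert x r' in (b, y :: r'')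
  else (None, [:: x]).

(* A tableau is the list of its rows, top row first.  The second component of
   the result is the index of the row that received a new cell. *)
Fixpoint tab_insert (x : nat) (t : seq (seq nat)) : seq (seq nat) * nat :=
  if t is r :: t' then
    let: (b, r') := row_insert x r in
    if b is Some y then
      let: (t'', j) := tab_insert y t' in (r' :: t'', j.+1)
    else (r' :: t', 0)
  else ([:: [:: x]], 0).

Definition add_cell (i j : nat) (t : seq (seq nat)) : seq (seq nat) :=
  set_nth [::] t j (rcons (nth [::] t j) i).

(* In PQ = (P, Q), P is the insertion tableau and Q the recording tableau;
   xi = (x, i) means that x is the i-th letter of the word. *)
Definition RS_step (PQ : seq (seq nat) * seq (seq nat)) (xi : nat * nat) :=
  let: (P, j) := tab_insert xi.1 PQ.1 in (P, add_cell xi.2 j PQ.2).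

Definition RS (w : seq nat) : seq (seq nat) * seq (seq nat) :=
  foldl RS_step ([::], [::]) (zip w (iota 1 (size w))).

Lemma shape_row_insert x r :
  size (row_insert x r).2 =
    if (row_insert x r).1 is Some _ then size r else (size r).+1.
Proof.
elim: r => //= y r IH; case: ifP => // _.
by case: (row_insert x r) IH => -[z|] r' /= ->.
Qed.

Lemma shape_tab_insert x t :
  shape (tab_insert x t).1 = incr_nth (shape t) (tab_insert x t).2.
Proof.
elim: t x => //= r t IH x; have := shape_row_insert x r.
case: (row_insert x r) => -[y|] r' /= <- //.
by have := IH y; case: (tab_insert y t) => t' j /= ->.
Qed.

Lemma shape_add_cell i j t : shape (add_cell i j t) = incr_nth (shape t) j.
Proof.
rewrite /add_cell; elim: t j => [|r t IH] [|j] //=.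
- by congr (_ :: _); elim: j => //= j ->.
- by rewrite size_rcons.
- by rewrite IH.
Qed.

Lemma shape_RS w : shape (RS w).1 = shape (RS w).2.
Proof.
rewrite /RS; elim/last_ind: (zip _ _) => [//|s xi IH].
rewrite -cats1 foldl_cat /=; case: (foldl _ _ s) IH => P Q /= IH.
rewrite /RS_step /=; have := shape_tab_insert xi.1 P.
by case: tab_insert => P' j /= ->; rewrite shape_add_cell IH.
Qed.

(* The common shape of P and Q; see shape_RS. *)
Definition sh (n : nat) (s : 'S_n) : seq nat := shape (RS (one_line s)).1.

Definition is_part (n : nat) (la : seq nat) : bool :=
  [&& sorted geq la, 0 \notin la & sumn la == n].

Definition two_row (n : nat) (la : seq nat) : bool :=
  is_part n la && (size la <= 2).

Definition ell_2row (n k : nat) : nat :=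
  #|[set s : 'S_n | (longest_inc (one_line s) == k) && two_row n (sh s)]|.

Definition inv_2row (n k : nat) : nat :=
  #|[set s : 'S_n | [&& (s ^+ 2 == 1)%g,
       longest_inc (one_line s) == k & two_row n (sh s)]]|.

Local Open Scope ring_scope.

(* The sequence l_1, ..., l_n is given by a function on nat, of which only the
   values at 1, ..., n are used. *)
Definition pad0 (R : realFieldType) (n : nat) (l : nat -> R) (k : nat) : R :=
  if (1 <= k <= n)%N then l k else 0.

Definition log_concave (R : realFieldType) (n : nat) (l : nat -> R) : Prop :=
  forall k : nat, (1 <= k <= n)%N ->
    pad0 n l k.-1 * pad0 n l k.+1 <= pad0 n l k ^+ 2.

(* Main.v *)
(* On permutations whose shape has at most two rows, the second row of the
   Robinson-Schensted tableau is the increasing word of the entries bumped out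
   of the first one, so the tableau P amounts to its first row and Q to the set
   of steps at which the first row grows.  Coding both as ballot sequences of
   length n with k ups, where k is the length of the first row, that is
   l(pi) by Schensted, reverse insertion makes pi |-> (P, Q) a bijection onto
   pairs of ballot sequences.  The letter j is in the first row of P when the
   longest increasing subsequence of the letters at most j is longer than that
   of the letters at most j - 1, and i is in the first row of Q when the same
   holds for positions; inverting pi exchanges letters and positions, so it
   exchanges P and Q, and it preserves 321-avoidance, that is, having at most
   two rows.  With b the number of ballot sequences, the two counts are thus
   b^2 and b, and b = C(n, k) - C(n, k + 1) = (2k + 1 - n) / (k + 1) C(n, k)
   is log-concave in k. *)

Require Import Defs.
From mathcomp Require Import all_boot all_order all_algebra all_fingroup.
From mathcomp Require Import zify ring.
Set Implicit Arguments.
Unset Strict Implicit.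
Unset Printing Implicit Defensive.
Import Order.TTheory GRing.Theory Num.Theory.

(** * Increasing words of natural numbers *)

Lemma sorted_ltn_cat a b :
  sorted ltn (a ++ b) = [&& sorted ltn a, sorted ltn b & allrel ltn a b].
Proof.
by rewrite !(sorted_pairwise ltn_trans) pairwise_cat andbC -andbA.
Qed.

Lemma sorted_ltn_rcons a x :
  sorted ltn (rcons a x) = sorted ltn a && all (fun z => z < x) a.
Proof. by rewrite !(sorted_pairwise ltn_trans) pairwise_rcons andbC. Qed.

Lemma sorted_ltn_eq (a b : seq nat) :
  sorted ltn a -> sorted ltn b -> a =i b -> a = b.
Proof. exact: (irr_sorted_eq ltn_trans ltnn). Qed.

Lemma count_all_leq v (s : seq nat) : all (leq^~ v) s -> count (leq^~ v) s = size s.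
Proof. by rewrite all_count => /eqP. Qed.

Lemma count_leq_full v x (s : seq nat) : all (fun z => z < x) s -> x <= v.+1 ->
  count (leq^~ v) s = size s.
Proof. by move=> sx xv; apply/count_all_leq/(sub_all _ sx) => z /=; lia. Qed.

Lemma count_leq_none v y (s : seq nat) : all (fun z => y < z) s -> v <= y ->
  count (leq^~ v) s = 0.
Proof.
move=> ys vy; apply/eqP; rewrite -leqn0 leqNgt -has_count; apply/hasPn.
by move=> z /(allP ys) /=; lia.
Qed.

Lemma filter_ltn_none y (s : seq nat) : all (fun z => y < z) s -> [seq z <- s | z < y] = [::].
Proof.
move=> ys; apply/eqP; rewrite -[_ == _]negbK -has_filter; apply/hasPn=> t.
by move=> /(allP ys) /=; lia.
Qed.

(** * Insertion into the first row *)

Variant row_insert_spec (x : nat) (r : seq nat) : option nat * seq nat -> Prop :=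
| RowAppend of all (fun z => z < x) r : row_insert_spec x r (None, rcons r x)
| RowBump a y b of r = a ++ y :: b & all (fun z => z < x) a & x < y
    & all (fun z => y < z) b :
    row_insert_spec x r (Some y, a ++ x :: b).

Lemma row_insertP x r :
  sorted ltn r -> x \notin r -> row_insert_spec x r (row_insert x r).
Proof.
elim: r => [|z r IH] /= srt; first by move=> _; apply: (@RowAppend x [::]).
rewrite inE negb_or => /andP[nxz nxr].
have allz : all (fun t => z < t) r by rewrite (order_path_min ltn_trans srt).
case: ifP => [xz|xz]; first exact: (@RowBump x (z :: r) [::] z r).
have zx : z < x by lia.
case: (IH (path_sorted srt) nxr) => [al|a y b -> al xy bl].
  by rewrite -rcons_cons; apply: RowAppend; rewrite /= zx.
by apply: (RowBump (r := z :: a ++ y :: b) (a := z :: a)); rewrite //= zx.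
Qed.

(* The first row, the word of entries bumped out of it, and the recording bits
   (true when the first row grows), most recent bit first. *)
Definition run_step (st : seq nat * seq nat * seq bool) (x : nat) :=
  let: (r, u, q) := st in
  let: (b, r') := row_insert x r in
  if b is Some y then (r', rcons u y, false :: q) else (r', u, true :: q).

Definition run (w : seq nat) := foldl run_step ([::], [::], [::]) w.
Definition toprow w := (run w).1.1.
Definition bumps w := (run w).1.2.
Definition bits w := (run w).2.

Lemma run_rcons w x : run (rcons w x) = run_step (run w) x.
Proof. by rewrite /run foldl_rcons. Qed.

Lemma runE w : run w = (toprow w, bumps w, bits w).
Proof. by rewrite /toprow /bumps /bits; case: (run w) => -[]. Qed.

Lemma uniq_rconsP (w : seq nat) x : uniq (rcons w x) -> uniq w /\ x \notin w.
Proof. by rewrite rcons_uniq => /andP[]. Qed.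

Lemma run_inv w : uniq w ->
  sorted ltn (toprow w) /\ perm_eq (toprow w ++ bumps w) w.
Proof.
elim/last_ind: w => [//|w x IH] /uniq_rconsP[uw nxw].
have [srt pe] := IH uw.
have nxr : x \notin toprow w.
  by move: nxw; rewrite -(perm_mem pe) mem_cat negb_or => /andP[].
rewrite {1}/toprow {1}/toprow {1}/bumps run_rcons runE /=.
case: (row_insertP srt nxr) => [al|a y b e al xy bl] /=.
  rewrite sorted_ltn_rcons srt al; split=> //.
  apply/seq.permP => P; move/seq.permP/(_ P): pe.
  by rewrite -!cats1 !count_cat /= => <-; rewrite addnAC.
rewrite e in srt pe.
have sub : sorted ltn (a ++ x :: b).
  move: srt; rewrite !sorted_ltn_cat /= => /and3P[-> pb].
  move=> /allrelP ab /=; rewrite (path_sortedE ltn_trans) (path_sorted pb) andbT.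
  apply/andP; split; first by apply/allP => z /(allP bl) /=; lia.
  apply/allrelP => i j ia; rewrite inE => /orP[/eqP->|jb]; first exact: (allP al).
  by apply: ab => //; rewrite inE jb orbT.
split => //; apply/seq.permP => P; move/seq.permP/(_ P): pe.
by rewrite -!cats1 !count_cat /= => <-; lia.
Qed.

Variant run_spec w x : seq nat -> seq nat -> seq bool -> Prop :=
| RunAppend of all (fun z => z < x) (toprow w) :
    run_spec w x (rcons (toprow w) x) (bumps w) (true :: bits w)
| RunBump a y b of toprow w = a ++ y :: b & all (fun z => z < x) a & x < y
    & all (fun z => y < z) b :
    run_spec w x (a ++ x :: b) (rcons (bumps w) y) (false :: bits w).

Lemma runP w x : uniq (rcons w x) ->
  run_spec w x (toprow (rcons w x)) (bumps (rcons w x)) (bits (rcons w x)).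
Proof.
move=> /uniq_rconsP[uw nxw]; have [srt pe] := run_inv uw.
have nxr : x \notin toprow w.
  by move: nxw; rewrite -(perm_mem pe) mem_cat negb_or => /andP[].
rewrite {1}/toprow {1}/bumps {1}/bits run_rcons runE /=.
by case: (row_insertP srt nxr) => [al|a y b e al xy bl] /=; constructor.
Qed.

Lemma toprow_sorted w : uniq w -> sorted ltn (toprow w).
Proof. by case/run_inv. Qed.

Lemma perm_run w : uniq w -> perm_eq (toprow w ++ bumps w) w.
Proof. by case/run_inv. Qed.

Lemma mem_run w z : uniq w -> (z \in w) = (z \in toprow w) || (z \in bumps w).
Proof. by move=> uw; rewrite -(perm_mem (perm_run uw)) mem_cat. Qed.

Lemma run_disj w z : uniq w -> z \in toprow w -> z \notin bumps w.
Proof.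
move=> uw zr; have := perm_uniq (perm_run uw); rewrite uw cat_uniq.
by case/and3P=> _ /hasPn h _; apply/negP => /h; rewrite /= zr.
Qed.

Lemma size_bits w : size (bits w) = size w.
Proof.
elim/last_ind: w => [//|w x IH]; rewrite /bits run_rcons runE /= size_rcons -IH.
by case: (row_insert _ _) => -[].
Qed.

Lemma count_bits w :
  count id (bits w) = size (toprow w) /\ count negb (bits w) = size (bumps w).
Proof.
elim/last_ind: w => [//|w x [IH1 IH2]].
rewrite /bits /toprow /bumps run_rcons runE /=; have := shape_row_insert x (toprow w).
by case: (row_insert _ _) => -[y|] r' /= ->; rewrite ?size_rcons IH1 IH2.
Qed.

(* Reverse row insertion: x is the largest entry below the bumped y. *)
Lemma run_inj w w' : uniq w -> uniq w' -> run w = run w' -> w = w'.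
Proof.
elim/last_ind: w w' => [|w x IH] w'.
  by move=> _ _ /(congr1 (fun t => size t.2)); rewrite -/(bits w') size_bits; case: w'.
case/lastP: w' => [_ _ /(congr1 (fun t => size t.2))|w' x' u u'].
  by rewrite -/(bits _) size_bits size_rcons.
rewrite !runE => -[].
have [uw _] := uniq_rconsP u; have [uw' _] := uniq_rconsP u'.
case: (runP u) => [_|a y b e al xy bl]; case: (runP u') => [_|a' y' b' e' al' xy' bl'] //.
  by move=> /rcons_inj[e1 ->] e2 [e3]; congr rcons; apply: IH; rewrite // !runE e1 e2 e3.
move=> e1 /rcons_inj[e2 ey] [e3]; subst y'.
(* The bumped [y] splits the new row: the part below [y] is [a] followed by [x], the part above is
   [b], so all three can be read off. *)
have lowE c z d : all (fun t => t < z) c -> z < y -> all (fun t => y < t) d ->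
    [seq t <- c ++ z :: d | t < y] = rcons c z /\
    [seq t <- c ++ z :: d | y < t] = d.
  move=> cz zy dy; rewrite !filter_cat /= zy ltnNge (ltnW zy) /= -cats1; split.
    congr (_ ++ _ :: _).
      by apply/all_filterP/allP => t /(allP cz) /=; lia.
    by apply/eqP; rewrite -[_ == _]negbK -has_filter; apply/hasPn=> t /(allP dy) /=; lia.
  rewrite (_ : [seq t <- c | y < t] = [::]) /=; first exact/all_filterP.
  by apply/eqP; rewrite -[_ == _]negbK -has_filter; apply/hasPn=> t /(allP cz) /=; lia.
have [l1 h1] := lowE _ _ _ al xy bl; have [l2 h2] := lowE _ _ _ al' xy' bl'.
rewrite e1 l2 in l1; rewrite e1 h2 in h1.
move/rcons_inj: l1 => [ea ->]; congr rcons; apply: IH => //.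
by rewrite !runE e e' ea h1 e2 e3.
Qed.

(** * The insertion tableau and its number of rows *)

Definition tabs (w : seq nat) := foldl (fun t x => (tab_insert x t).1) [::] w.

Lemma RS_tabs w : (RS w).1 = tabs w.
Proof.
have gen P Q m : (foldl RS_step (P, Q) (zip w (iota m (size w)))).1 =
    foldl (fun t x => (tab_insert x t).1) P w.
  elim: w P Q m => [//|x w IH] P Q m /=.
  by rewrite -(IH _ (add_cell m (tab_insert x P).2 Q) m.+1) /RS_step; case: tab_insert.
exact: gen.
Qed.

(** Each bumped entry goes at once into the rows below, so these rows receive exactly the word
    [bumps], in order. *)
Lemma tabs_cons x w : tabs (x :: w) = toprow (x :: w) :: tabs (bumps (x :: w)).
Proof.
elim/last_ind: w => [//|w z IH]; move: IH; rewrite -rcons_cons.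
move: (x :: w) => u IH.
rewrite /toprow /bumps run_rcons runE /= {1}/tabs foldl_rcons -/(tabs u) IH /=.
case: (row_insert _ _) => -[y|] r' //=.
by rewrite /tabs foldl_rcons; case: tab_insert.
Qed.

Lemma bumps_nil u : bumps u = [::] -> toprow u = u.
Proof.
elim/last_ind: u => [//|u x]; rewrite /toprow /bumps run_rcons runE /=.
have := shape_row_insert x (toprow u).
case E: (row_insert _ _) => [[y|] r'] /=; first by case: (bumps u).
move=> _ IH /IH e; move: E; rewrite e => E.
elim: u {IH e} r' E => [|z u IH] r' /=; first by case=> <-.
case: ifP => // _; move: IH; case: row_insert => b r'' IH [eb <-].
by rewrite (IH r'') // eb.
Qed.

Lemma run_of_sorted u : sorted ltn u -> toprow u = u /\ bumps u = [::].
Proof.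
elim/last_ind: u => [//|u x IH] s.
have uu := sorted_uniq ltn_trans ltnn s.
move: s; rewrite sorted_ltn_rcons => /andP[/IH[e1 e2] al].
case: (runP uu) => [_|a y b e _ xy _]; rewrite ?e1 ?e2 //.
move/allP/(_ y): al; rewrite -e1 e mem_cat inE eqxx orbT => /(_ isT); lia.
Qed.

(** Two uses of [tabs_cons] leave, below the second row, the tableau of the word bumped by
    [bumps w]; that word is empty exactly when [bumps w] is increasing. *)
Lemma size_tabs_le2 w : uniq w -> (size (tabs w) <= 2) = sorted ltn (bumps w).
Proof.
move=> uw; have := perm_uniq (perm_run uw); rewrite uw cat_uniq => /and3P[_ _ ub].
case: w uw ub => [//|x w] uw ub; rewrite tabs_cons /= ltnS.
case: (bumps (x :: w)) ub => [//|y u] ub; rewrite tabs_cons [size _]/= ltnS leqn0.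
apply/idP/idP => [|/run_of_sorted[_ ->] //].
have : bumps (y :: u) = [::] -> sorted ltn (y :: u).
  by move=> /bumps_nil <-; apply: toprow_sorted.
by case: (bumps _) => [h _|z v _]; [apply: h | rewrite tabs_cons].
Qed.

(* For increasing rows r and u, this says that the tableau with rows r and u
   has increasing columns. *)
Definition dominates (r u : seq nat) :=
  forall v, count (leq^~ v) u <= count (leq^~ v) r.

Lemma run_dominates w : uniq w -> sorted ltn (bumps w) -> dominates (toprow w) (bumps w).
Proof.
elim/last_ind: w => [//|w x IH] u; have [uw _] := uniq_rconsP u.
case: (runP u) => [_ /(IH uw) d v|a y b e _ xy bl].
  by rewrite -cats1 count_cat (leq_trans (d v)) ?leq_addr.
rewrite sorted_ltn_rcons => /andP[/(IH uw) d ub] v.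
(* All earlier bumps lie below [y], so domination at [y.-1] gives at least as many row entries below
   [y]; the letter [x], replacing [y], supplies one more to match the new bump. *)
have := d v; have := d y.-1; rewrite e -cats1 !count_cat /=.
rewrite (_ : y <= y.-1 = false) ?addn0; last by lia.
rewrite (count_leq_none bl (leq_pred y)) (count_leq_full ub (leqSpred y)).
have hs := count_size (leq^~ v) (bumps w).
case: (leqP y v) => yv; last by lia.
have : count (leq^~ y.-1) a <= count (leq^~ v) a by apply: sub_count => z /=; lia.
lia.
Qed.

Lemma dominates_size r u : dominates r u -> size u <= size r.
Proof.
move=> d; set v := \max_(i <- r ++ u) i.
have al : all (leq^~ v) (r ++ u) by apply/allP => z zr; apply: leq_bigmax_seq.
move: al; rewrite all_cat => /andP[ar au].
by have := d v; rewrite !count_all_leq.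
Qed.

Lemma size_run w : uniq w -> size (toprow w) + size (bumps w) = size w.
Proof. by move=> uw; rewrite -size_cat (perm_size (perm_run uw)). Qed.

Lemma two_row_tabs w : uniq w ->
  two_row (size w) (shape (tabs w)) = sorted ltn (bumps w).
Proof.
move=> uw; rewrite /two_row size_map size_tabs_le2 //.
case s: (sorted _ _); rewrite ?andbF // andbT.
have d := dominates_size (run_dominates uw s).
have sz := size_run uw.
case: w uw s d sz => [//|x w] uw s d sz.
rewrite tabs_cons /is_part; case E: (bumps _) s d sz => [|y u] s d sz.
  by move: sz; rewrite /= inE /= !addn0 => ->; rewrite eqxx.
rewrite tabs_cons; have [e1 e2] := run_of_sorted s; rewrite e1 e2.
move: d sz; rewrite /= !inE; lia.
Qed.

(** * Two rows and 321-avoidance *)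
Definition has321 (w : seq nat) :=
  exists z y x, [/\ subseq [:: z; y; x] w, y < z & x < y].

Lemma subseq2_rcons (w : seq nat) z y x :
  subseq [:: z; y] (rcons w x) -> subseq [:: z; y] w \/ z \in w /\ y = x.
Proof.
rewrite -subseq_rev rev_rcons /=.
have -> : rev [:: z; y] = [:: y; z] by [].
case: eqP => [->|_] h; last by left; rewrite -subseq_rev.
by right; split=> //; move: h; rewrite sub1seq mem_rev.
Qed.

Lemma subseq3_rcons (w : seq nat) z y t x :
  subseq [:: z; y; t] (rcons w x) ->
  subseq [:: z; y; t] w \/ subseq [:: z; y] w /\ t = x.
Proof.
rewrite -subseq_rev rev_rcons /=.
have -> : rev [:: z; y; t] = [:: t; y; z] by [].
case: eqP => [->|_] h; last by left; rewrite -subseq_rev.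
by right; split=> //; rewrite -subseq_rev.
Qed.

Lemma subseq_rcons2 (w : seq nat) z x : z \in w -> subseq [:: z; x] (rcons w x).
Proof.
move=> zw; rewrite -cats1; apply: (@cat_subseq _ [:: z] [:: x]) => //.
by rewrite sub1seq.
Qed.

(** The witness [t] is the letter that bumped [z] if [y] was in the row by then, and [y] itself if
    it came later. *)
Lemma bumped_before_row w z y : uniq w -> z \in bumps w -> y \in toprow w -> y < z ->
  exists t, [/\ y <= t, t < z & subseq [:: z; t] w].
Proof.
elim/last_ind: w => [//|w x IH] u; have [uw nxw] := uniq_rconsP u.
have mono t : subseq [:: z; t] w -> subseq [:: z; t] (rcons w x).
  by move=> h; apply: subseq_trans h (subseq_rcons _ _).
case: (runP u) => [_|a y' b e al xy bl] zb.
  rewrite mem_rcons inE => /orP[/eqP->|yr] yz.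
    by exists x; rewrite subseq_rcons2 // (mem_run z uw) zb orbT.
  by have [t [? ? /mono ?]] := IH uw zb yr yz; exists t.
move=> yr yz; move: zb; rewrite mem_rcons inE => /orP[/eqP ez|zb].
  subst z; exists x; split => //; last first.
    by rewrite subseq_rcons2 // (mem_run _ uw) e mem_cat inE eqxx orbT.
  move: yr; rewrite mem_cat inE => /or3P[/(allP al) /ltnW //|/eqP-> //|].
  by move=> /(allP bl) /=; lia.
have [yx|nyx] := eqVneq y x.
  by subst y; exists x; rewrite subseq_rcons2 // (mem_run z uw) zb orbT.
have yr' : y \in toprow w.
  by move: yr; rewrite e !mem_cat !inE (negbTE nyx) /= orbCA => ->; rewrite orbT.
by have [t [? ? /mono ?]] := IH uw zb yr' yz; exists t.
Qed.

(** If [x] bumps [y] after a larger [z] was bumped, the letter [t] of [bumped_before_row] completes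
    a pattern [z > t > x]. *)
Lemma avoid_sorted w : uniq w -> ~ has321 w -> sorted ltn (bumps w).
Proof.
elim/last_ind: w => [//|w x IH] u no; have [uw nxw] := uniq_rconsP u.
have no' : ~ has321 w.
  move=> [z [y [t [s yz ty]]]]; apply: no; exists z, y, t; split=> //.
  exact: subseq_trans s (subseq_rcons _ _).
case: (runP u) => [_|a y b e al xy bl]; first exact: IH.
rewrite sorted_ltn_rcons IH //=; apply/allP => z zb /=.
have yr : y \in toprow w by rewrite e mem_cat inE eqxx orbT.
rewrite ltnNge; apply/negP; rewrite leq_eqVlt => /orP[/eqP ez|yz].
  by have := run_disj uw yr; rewrite ez zb.
have [t [yt tz s]] := bumped_before_row uw zb yr yz.
apply: no; exists z, t, x; split=> //; last by lia.
by rewrite -cats1; apply: (@cat_subseq _ [:: z; t] [:: x]).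
Qed.

(** When [y] arrives, either it bumps a larger entry, which serves as [t], or it is appended, and
    then [z] must have been bumped already. *)
Lemma inversion_bumps w z y : uniq w -> subseq [:: z; y] w -> y < z ->
  exists2 t, t \in bumps w & y < t.
Proof.
elim/last_ind: w => [//|w x IH] u; have [uw nxw] := uniq_rconsP u.
move=> /subseq2_rcons[s yz|[zw ->] yz].
  have [t tb yt] := IH uw s yz; exists t => //.
  by case: (runP u) => // *; rewrite mem_rcons inE tb orbT.
case: (runP u) => [al|a y' b e al xy bl].
  move: zw; rewrite (mem_run _ uw) => /orP[/(allP al) /=|zb]; first by lia.
  by exists z.
by exists y' => //; rewrite mem_rcons inE eqxx.
Qed.

(** By the time [y] is bumped, [inversion_bumps] has already placed a larger entry in the bumped
    word. *)
Lemma sorted_bumps_inversion w z y : uniq w -> sorted ltn (bumps w) ->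
  y \in bumps w -> y < z -> ~ subseq [:: z; y] w.
Proof.
elim/last_ind: w => [//|w x IH] u; have [uw nxw] := uniq_rconsP u.
have yw : y \in bumps w -> subseq [:: z; y] (rcons w x) -> subseq [:: z; y] w.
  move=> yb /subseq2_rcons[//|[_ yx]]; move: nxw.
  by rewrite (mem_run _ uw) -yx yb orbT.
case: (runP u) => [_|a y' b e al xy bl] srt yb yz s.
  exact: IH (yw yb s).
move: srt; rewrite sorted_ltn_rcons => /andP[srt ub].
move: yb; rewrite mem_rcons inE => /orP[/eqP ey|yb]; last exact: IH (yw yb s).
subst y'; case/subseq2_rcons: s => [s|[_ yx]]; last by lia.
have [t /(allP ub) /=] := inversion_bumps uw s yz; lia.
Qed.

(** Consider the arrival of the last letter [x] of a pattern. Either the middle letter [y] has been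
    bumped, against [sorted_bumps_inversion], or [x] bumps an entry at most [y], after the bump
    larger than [y] given by [inversion_bumps]. *)
Lemma sorted_avoid w : uniq w -> sorted ltn (bumps w) -> ~ has321 w.
Proof.
elim/last_ind: w => [|w x IH] u srt [z [y [t [s yz ty]]]]; first by move: s.
have [uw nxw] := uniq_rconsP u.
case/subseq3_rcons: s => [s|[s tx]].
  apply: IH => //; last by exists z, y, t.
  by move: srt; case: (runP u) => // a y' b _ _ _ _; rewrite sorted_ltn_rcons => /andP[].
have yw : y \in w by apply: (mem_subseq s); rewrite !inE eqxx orbT.
move: srt yw; rewrite (mem_run _ uw); subst t.
case: (runP u) => [al|a y' b e al xy bl] srt.
  case/orP=> [/(allP al) /=|yb]; first by lia.
  exact: (sorted_bumps_inversion uw srt yb yz).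
move: srt; rewrite sorted_ltn_rcons => /andP[srt ub].
case/orP=> [yr|yb]; last exact: (sorted_bumps_inversion uw srt yb yz).
have [t tb yt] := inversion_bumps uw s yz.
have := allP ub _ tb; move: yr; rewrite /= e mem_cat inE.
case/or3P => [/(allP al) /=|/eqP|/(allP bl) /=]; lia.
Qed.

(** * Longest increasing subsequences *)
(** The inductive step of [toprow_chain], shared by appending and bumping: a chain ending at the
    last entry of [a] is prolonged by [x]. *)
Lemma toprow_extend w a d x : uniq w -> toprow w = a ++ d -> all (fun z => z < x) a ->
  (forall c, c \in toprow w -> exists v, [/\ subseq (rcons v c) w,
     sorted ltn (rcons v c) & size v = count (ltn^~ c) (toprow w)]) ->
  exists v, [/\ subseq (rcons v x) (rcons w x), sorted ltn (rcons v x)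
    & size v = size a].
Proof.
case/lastP: a => [|a c] uw e al IH.
  by exists [::]; rewrite /= sub1seq mem_rcons inE eqxx.
have cr : c \in toprow w by rewrite e mem_cat mem_rcons inE eqxx.
have cx : c < x by apply: (allP al); rewrite mem_rcons inE eqxx.
have [v [s1 s2 s3]] := IH _ cr.
exists (rcons v c); split.
- by rewrite -!(cats1 _ x); apply: cat_subseq.
- rewrite sorted_ltn_rcons s2 all_rcons cx /=; apply/allP=> z zv.
  by move: s2; rewrite sorted_ltn_rcons => /andP[_ /allP/(_ z zv)] /=; lia.
rewrite !size_rcons s3; congr _.+1.
have := toprow_sorted uw; rewrite e -cats1 -catA sorted_ltn_cat.
case/and3P=> _ pd /allrelP acd; rewrite !count_cat.
rewrite (_ : count (ltn^~ c) a = size a); last first.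
  by apply/eqP; rewrite -all_count; apply/allP=> z za; apply: acd; rewrite ?inE ?eqxx.
rewrite (_ : count (ltn^~ c) [:: c] = 0) /= ?ltnn // add0n.
rewrite (_ : count (ltn^~ c) d = 0) ?addn0 //.
apply/eqP; rewrite -leqn0 leqNgt -has_count; apply/hasPn=> z zd /=.
by have := allP (order_path_min ltn_trans pd) _ zd; rewrite /=; lia.
Qed.

(** [count (ltn^~ c)] is the column of [c], counted from 0; when [c] enters the row, its left
    neighbour already ends a chain that [c] prolongs. *)
Lemma toprow_chain w c : uniq w -> c \in toprow w ->
  exists v, [/\ subseq (rcons v c) w, sorted ltn (rcons v c)
    & size v = count (ltn^~ c) (toprow w)].
Proof.
elim/last_ind: w c => [//|w x IH] c u; have [uw nxw] := uniq_rconsP u.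
have mono v : subseq v w -> subseq v (rcons w x).
  by move=> h; apply: subseq_trans h (subseq_rcons _ _).
have ext := toprow_extend uw _ _ (fun c => IH c uw).
case: (runP u) => [al|a y b e al xy bl].
  rewrite mem_rcons inE => /orP[/eqP->|cr].
    have [v [s1 s2 s3]] := ext _ [::] x (esym (cats0 _)) al.
    exists v; split=> //; rewrite s3 -cats1 count_cat /= ltnn.
    by rewrite !addn0; apply/esym/eqP; rewrite -all_count.
  have [v [s1 s2 s3]] := IH _ uw cr.
  exists v; split=> //; first exact: mono.
  rewrite s3 -cats1 count_cat /= !addn0.
  by rewrite ltnNge (ltnW (allP al _ cr)) addn0.
have [-> _|cx] := eqVneq c x.
  have [v [s1 s2 s3]] := ext _ _ x e al.
  exists v; split=> //; rewrite s3 count_cat /= ltnn.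
  rewrite (_ : count (ltn^~ x) b = 0).
    by rewrite !addn0; apply/esym/eqP; rewrite -all_count.
  apply/eqP; rewrite -leqn0 leqNgt -has_count; apply/hasPn=> z /(allP bl) /=; lia.
rewrite mem_cat inE (negbTE cx) /= => cab.
have cr : c \in toprow w by rewrite e mem_cat inE orbCA cab orbT.
have [v [s1 s2 s3]] := IH _ uw cr.
exists v; split=> //; first exact: mono.
rewrite s3 e !count_cat /=; congr (_ + (nat_of_bool _ + _)).
by case/orP: cab => [/(allP al)|/(allP bl)] /=; lia.
Qed.

(** The number of row entries at most [c] never drops, since a bump replaces an entry by a smaller
    one; it exceeds the length of [v] once [c] is inserted. *)
Lemma chain_toprow w v c : uniq w -> subseq (rcons v c) w -> sorted ltn (rcons v c) ->
  size v < count (leq^~ c) (toprow w).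
Proof.
elim/last_ind: w v c => [|w x IH] v c u; first by case: v.
have [uw nxw] := uniq_rconsP u.
rewrite -subseq_rev !rev_rcons /=; case: eqP => [->|_].
  rewrite subseq_rev => vw; rewrite sorted_ltn_rcons => /andP[sv vx].
  have : size v <= count (leq^~ x) (toprow w).
    case/lastP: v vw sv vx => [//|v c'] vw sv vx; rewrite size_rcons.
    apply: leq_trans (IH _ _ uw vw sv) _; apply: sub_count => z /=.
    by have := allP vx c'; rewrite mem_rcons inE eqxx => /(_ isT) /=; lia.
  case: (runP u) => [al|a y b e al xy bl].
    by rewrite -cats1 count_cat /= leqnn addn1 ltnS.
  by rewrite e !count_cat /= leqnn; lia.
rewrite -rev_rcons subseq_rev => vw sv; apply: leq_trans (IH _ _ uw vw sv) _.
case: (runP u) => [al|a y b e al xy bl]; first by rewrite -cats1 count_cat leq_addr.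
rewrite e !count_cat /=; lia.
Qed.

Lemma chain_le_toprow w v : uniq w -> subseq v w -> sorted ltn v -> size v <= size (toprow w).
Proof.
case/lastP: v => [//|v c] uw vw sv; rewrite size_rcons.
by apply: leq_trans (chain_toprow uw vw sv) (count_size _ _).
Qed.

Lemma chain_eq_toprow w : uniq w ->
  exists v, [/\ subseq v w, sorted ltn v & size v = size (toprow w)].
Proof.
move=> uw; have := toprow_sorted uw; case/lastP E: (toprow w) => [|r c].
  by exists [::]; rewrite sub0seq.
have cr : c \in toprow w by rewrite E mem_rcons inE eqxx.
have [v [s1 s2 s3]] := toprow_chain uw cr.
rewrite sorted_ltn_rcons => /andP[_ al]; exists (rcons v c); split=> //.
rewrite !size_rcons s3 E -cats1 count_cat /= ltnn !addn0.
by congr _.+1; apply/eqP; rewrite -all_count.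
Qed.

Lemma longest_inc_toprow w : uniq w -> longest_inc w = size (toprow w).
Proof.
move=> uw; apply/eqP; rewrite /longest_inc eqn_leq; apply/andP; split.
  by apply/bigmax_leqP => m sm; apply: chain_le_toprow; rewrite ?mask_subseq.
have [v [/subseqP[m sm ->] sv <-]] := chain_eq_toprow uw.
by apply: (bigop.bigmax_sup (Tuple (introT eqP sm))).
Qed.

(** * Restriction to the small letters *)

Lemma row_insert_append x r : all (fun z => z < x) r -> row_insert x r = (None, rcons r x).
Proof.
by elim: r => //= y r IH /andP[yx /IH ->]; rewrite ltnNge (ltnW yx).
Qed.

Lemma row_insert_bump x a y b : all (fun z => z < x) a -> x < y ->
  row_insert x (a ++ y :: b) = (Some y, a ++ x :: b).
Proof.
move=> al xy; elim: a al => [|z a IH] /=; first by rewrite xy.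
by move=> /andP[zx /IH ->]; rewrite ltnNge (ltnW zx).
Qed.

Lemma toprow_rcons w x : toprow (rcons w x) = (row_insert x (toprow w)).2.
Proof. by rewrite {1}/toprow run_rcons runE /=; case: row_insert => -[]. Qed.

(** The entries at most [j] form an initial segment of the row that larger letters never disturb; a
    small letter bumping a large one is, within this segment, appended. *)
Lemma toprow_filter w j : uniq w -> toprow [seq z <- w | z <= j] = [seq z <- toprow w | z <= j].
Proof.
elim/last_ind: w => [//|w x IH] u; have [uw nxw] := uniq_rconsP u.
have sub P (s : seq nat) : all (fun z => z < x) s -> all (fun z => z < x) (filter P s).
  by move=> al; apply/allP => z; rewrite mem_filter => /andP[_ /(allP al)].
rewrite filter_rcons; case: ifP => xj; first rewrite toprow_rcons; rewrite IH //;
    case: (runP u) => [al|a y b e al xy bl].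
- by rewrite row_insert_append ?sub // filter_rcons xj.
- rewrite e !filter_cat /= xj; case: ifP => yj; first by rewrite row_insert_bump ?sub.
  rewrite (_ : [seq z <- b | z <= j] = [::]).
    by rewrite cats0 row_insert_append ?sub //= cats1.
  by apply/eqP; rewrite -[_ == _]negbK -has_filter; apply/hasPn=> z /(allP bl) /=; lia.
- by rewrite filter_rcons xj.
- by rewrite e !filter_cat /= xj (_ : y <= j = false) //; lia.
Qed.

(** * Ballot sequences *)

(* Sequences are read from right to left, the order in which consing builds them. *)
Fixpoint ballot (q : seq bool) : bool :=
  if q is b :: q' then (count negb q <= count id q) && ballot q' else true.

Lemma ballot_count q : ballot q -> count negb q <= count id q.
Proof. by case: q => //= b q /andP[]. Qed.

(** The test is the ballot condition on the whole sequence, [n - k <= k]. It fails for [k = 0] with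
    [n] positive, so [k.-1] is a genuine predecessor. *)
Fixpoint ballots (n k : nat) : seq (seq bool) :=
  if n is m.+1 then
    if n <= k.*2 then
      [seq true :: q | q <- ballots m k.-1] ++ [seq false :: q | q <- ballots m k]
    else [::]
  else if k == 0 then [:: [::]] else [::].

Lemma mem_ballots n k q :
  (q \in ballots n k) = [&& size q == n, ballot q & count id q == k].
Proof.
elim: n k q => [|n IH] k q /=.
  case: k => [|k]; rewrite ?inE; first by case: q.
  by apply/esym/negbTE/negP => /and3P[/nilP->].
have inc b t s : (t \in [seq b :: q | q <- s]) =
    if t is c :: t' then (c == b) && (t' \in s) else false.
  case: t => [|c t]; first by apply/negP => /mapP[].
  apply/mapP/andP => [[t' ts [-> ->]]|[/eqP-> ts]]; first by rewrite eqxx.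
  by exists t.
have cC (t : seq bool) : count negb t = size t - count id t.
  by rewrite -(count_predC id t) addKn.
case: q => [|b q].
  by case: ifP; rewrite // mem_cat !inc.
have cs := count_size id q.
rewrite [size _]/= [ballot _]/= cC; case: ifP => nk; last first.
  apply/esym/negP => /and3P[/eqP sz /andP[le _] /eqP ck].
  by move: le nk; rewrite /= -!sz in ck *; lia.
rewrite mem_cat !inc !IH; case: b => /=; rewrite ?orbF ?eqSS;
  case: (size q =P n) => //= e; case: (ballot q); rewrite ?andbF //= ?andbT.
  apply/eqP/andP => [|[_ /eqP]]; lia.
apply/eqP/andP => [|[_ /eqP]]; lia.
Qed.

Lemma uniq_ballots n k : uniq (ballots n k).
Proof.
elim: n k => [|n IH] k /=; first by case: ifP.
case: ifP => // _; rewrite cat_uniq !map_inj_uniq ?IH ?andbT /=; try by move=> ? ? [].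
by apply/hasPn => t /mapP[t' _ ->]; apply/negP => /mapP[].
Qed.

Lemma ballot_bits w : uniq w -> sorted ltn (bumps w) -> ballot (bits w).
Proof.
elim/last_ind: w => [//|w x IH] u s; have [uw nxw] := uniq_rconsP u.
have [c1 c2] := count_bits (rcons w x).
have := dominates_size (run_dominates u s); rewrite -c1 -c2.
move: s; case: (runP u) => [_ s|a y b _ _ _ _]; last rewrite sorted_ltn_rcons => /andP[s _].
all: by move=> le; apply/andP; split; [exact: le | exact: IH].
Qed.

(** The code of an insertion tableau by its first row, in the right-to-left order of [bits]: the bit
    of the largest letter is the head. *)
Fixpoint top_bits (r : seq nat) (m : nat) : seq bool :=
  if m is m'.+1 then (m \in r) :: top_bits r m' else [::].

Lemma size_top_bits r m : size (top_bits r m) = m.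
Proof. by elim: m => //= m ->. Qed.

Lemma count_leqS (r : seq nat) m : uniq r ->
  count (leq^~ m.+1) r = (m.+1 \in r) + count (leq^~ m) r.
Proof.
move=> ur; rewrite -count_uniq_mem // -count_predUI.
rewrite (eq_count (a2 := pred0) (a1 := predI _ _)) ?count_pred0 ?addn0; last by move=> z /=; lia.
by apply: eq_count => z /=; lia.
Qed.

Lemma count_top_bits r u n m : perm_eq (r ++ u) (iota 1 n) -> m <= n ->
  count id (top_bits r m) = count (leq^~ m) r /\
  count negb (top_bits r m) = count (leq^~ m) u.
Proof.
move=> ru; have := perm_uniq ru; rewrite iota_uniq cat_uniq => /and3P[ur /hasPn dis uu].
have mem z : (z \in r) || (z \in u) = (0 < z <= n).
  by rewrite -mem_cat (perm_mem ru) mem_iota add1n ltnS.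
elim: m => [|m IH] mn /=.
  by split; apply/esym/eqP; rewrite -leqn0 leqNgt -has_count; apply/hasPn=> z zin;
     have := mem z; rewrite /= zin ?orbT; lia.
have [-> ->] := IH (ltnW mn); rewrite !count_leqS //; split=> //.
congr (nat_of_bool _ + _); have := mem m.+1; rewrite ltnS mn.
by case: (boolP (m.+1 \in u)) => [/dis /= ->|]; rewrite ?orbF // => _ ->.
Qed.

(** The ballot inequality for the letters up to [m] is domination at the threshold [m]; thresholds
    beyond [n] reduce to [n], as no letter exceeds it. *)
Lemma ballot_dominates r u n : perm_eq (r ++ u) (iota 1 n) ->
  ballot (top_bits r n) <-> dominates r u.
Proof.
move=> ru; have key : ballot (top_bits r n) <->
    (forall m, m <= n -> count (leq^~ m) u <= count (leq^~ m) r).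
  have : n <= n by [].
  elim: {1 3 4}n => [|m IH] mn; first by split=> // _ m; rewrite leqn0 => /eqP->;
    have [<- <-] := count_top_bits ru (leq0n n).
  have [e1 e2] := count_top_bits ru mn; rewrite /= in e1 e2.
  rewrite /= e1 e2; split => [/andP[h /(IH (ltnW mn)) h'] k|h].
    by rewrite leq_eqVlt => /orP[/eqP->|] //; apply: h'.
  by rewrite h //; apply/IH => // [|k km]; [exact: ltnW | apply: h; lia].
rewrite key; split=> [h v|h m _]; last exact: h.
have mem z : z \in r ++ u -> z <= n.
  by rewrite (perm_mem ru) mem_iota; lia.
have cmin (s : seq nat) : {subset s <= r ++ u} -> count (leq^~ v) s = count (leq^~ (minn v n)) s.
  by move=> sub; apply: eq_in_count => z /sub /mem /=; lia.
rewrite !cmin; first by apply: h; lia.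
all: by move=> z zin; rewrite mem_cat zin ?orbT.
Qed.

Fixpoint row_of (p : seq bool) : seq nat :=
  if p is b :: p' then if b then rcons (row_of p') (size p) else row_of p'
  else [::].

Lemma perm_row_of p :
  perm_eq (row_of p ++ row_of [seq ~~ b | b <- p]) (iota 1 (size p)).
Proof.
elim: p => [//|b p IH].
rewrite [size _]/= -[X in iota _ X]addn1 iotaD add1n /= size_map.
apply/seq.permP => P; move/seq.permP/(_ P): IH.
by case: b => /=; rewrite -?cats1 !count_cat => <- /=; lia.
Qed.

Lemma row_of_bound p z : z \in row_of p -> z <= size p.
Proof.
move=> zin; have : z \in iota 1 (size p) by rewrite -(perm_mem (perm_row_of p)) mem_cat zin.
by rewrite mem_iota; lia.
Qed.

Lemma sorted_row_of p : sorted ltn (row_of p).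
Proof.
elim: p => [//|[] p IH] //=; rewrite sorted_ltn_rcons IH.
by apply/allP => z /row_of_bound.
Qed.

Lemma top_bits_row_of p : top_bits (row_of p) (size p) = p.
Proof.
elim: p => [//|b p IH] /=; congr (_ :: _).
  case: b; first by rewrite mem_rcons inE eqxx.
  by apply/negP => /row_of_bound; rewrite ltnn.
rewrite -[RHS]IH; case: b => //=; have : size p <= size p by [].
elim: {1 4 5}(size p) => [//|m IHm] mp /=; rewrite mem_rcons inE IHm ?(ltnW mp) //.
by rewrite (_ : (m.+1 == _) = false) //; lia.
Qed.

(** Reverse insertion, starting from the most recent bit. An up removes the largest entry of [r]; a
    down takes the last entry [y] of [u] back into [r], in place of the largest entry [x] below [y].
    Each time domination has to be recovered. *)
Lemma run_surj q r u : sorted ltn r -> sorted ltn u -> uniq (r ++ u) ->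
  dominates r u -> ballot q -> count id q = size r -> count negb q = size u ->
  exists2 w, perm_eq w (r ++ u) & run w = (r, u, q).
Proof.
elim: q r u => [|[] q IH] r u sr su uru d bq c1 c2.
- exists [::]; first by case: r c1 {sr uru d} => //; case: u c2 {su}.
  by case: r c1 {sr uru d} => //; case: u c2 {su}.
- have bq' : ballot q by case/andP: bq.
  case/lastP: r sr uru d c1 => [//|r x] sr uru d; rewrite size_rcons => -[c1].
  move: (sr); rewrite sorted_ltn_rcons => /andP[sr' rx].
  have [|v|w pw rw] := IH r u sr' su _ _ bq' c1 c2.
  + by move: uru; rewrite cat_rcons -cat1s uniq_catCA cat_uniq => /and3P[].
  (* Once [x <= v], the shortened row is counted in full, and the ballot condition on [q] makes it
     at least as long as [u]. *)
  + have := d v; rewrite -cats1 count_cat /= addn0.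
    case: (leqP x v) => xv; last by rewrite /= addn0.
    rewrite addn1 (count_leq_full rx (leqW xv)) => _.
    by apply: leq_trans (count_size _ _) _; rewrite -c1 -c2; exact: ballot_count.
  exists (rcons w x); last by rewrite run_rcons rw /= row_insert_append.
  apply/seq.permP => P; move/seq.permP/(_ P): pw.
  by rewrite -!cats1 !count_cat /= => ->; clear; lia.
have bq' : ballot q by case/andP: bq.
case/lastP: u su uru d c2 => [//|u y] su uru d; rewrite size_rcons => -[c2].
move: (su); rewrite sorted_ltn_rcons => /andP[su' uy].
have yr : y \notin r.
  by move: uru; rewrite cat_uniq has_rcons negb_or => /and3P[_ /andP[]].
have er : r = [seq z <- r | z < y] ++ [seq z <- r | y < z].
  elim: (r) sr yr => [//|z s IHs] /= ps; rewrite inE negb_or => /andP[yz ys].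
  case: (ltngtP z y) yz => // zy _; first by rewrite {1}(IHs (path_sorted ps) ys).
  have ys' : all (fun t => y < t) s.
    apply/allP => t /(allP (order_path_min ltn_trans ps)); exact: ltn_trans.
  by rewrite (filter_ltn_none ys') (all_filterP ys').
(* Domination at [y] forces some row entry below [y], so a letter [x] to remove exists; it also
   shows that the entries before [x] are at least as many as those remaining in [u]. *)
have := d y; rewrite {1}er count_cat -{1}cats1 count_cat /= leqnn addn0.
rewrite (count_leq_full uy (leqnSn y)).
have ay := filter_all (fun z => z < y) r; have yb := filter_all (fun z => y < z) r.
move: er ay yb; move: [seq z <- r | z < y] [seq z <- r | y < z] => a b er ay yb.
rewrite (count_leq_none yb (leqnn y)) (count_leq_full ay (leqnSn y)).
case/lastP: a ay er => [_ _|a x]; first by rewrite /= addn1.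
rewrite all_rcons size_rcons cat_rcons => /andP[xy ay] er sz; subst r.
have mvA : perm_eq ((a ++ y :: b) ++ u) (a ++ b ++ rcons u y).
  by apply/seq.permP => P; rewrite -cats1 !count_cat /=; clear; lia.
have srt : sorted ltn (a ++ y :: b).
  move: sr; rewrite !sorted_ltn_cat /= !(path_sortedE ltn_trans) yb.
  move=> /and3P[-> /andP[_ ->]] /allrelP h /=.
  apply/allrelP => i j ia; rewrite inE => /orP[/eqP->|jb]; first exact: (allP ay).
  by apply: h; rewrite // inE jb orbT.
have ay' : all (fun z => z < x) a.
  move: sr; rewrite sorted_ltn_cat => /and3P[_ _ /allrelP h].
  by apply/allP => z za; apply: h; rewrite ?inE ?eqxx.
have [|v||||w pw rw] := IH (a ++ y :: b) u srt su'.
- rewrite (perm_uniq mvA) //.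
  by apply: subseq_uniq uru; rewrite -catA cat_subseq // subseq_cons.
(* For [x <= v] all of [a] is counted, which suffices by [sz]; for [v < x] neither [x] nor [y] is
   counted. *)
- have := d v; rewrite -cats1 !count_cat /= addn0.
  case: (leqP x v) => xv; last by move: (leq_addl (y <= v) (count (leq^~ v) u)); clear; lia.
  rewrite (count_leq_full ay' (leqW xv)).
  by move: sz (count_size (leq^~ v) u); clear; lia.
- by [].
- by move: c1; rewrite !size_cat.
- by [].
exists (rcons w x).
  apply/seq.permP => P; move/seq.permP/(_ P): pw.
  by rewrite -!cats1 !count_cat /= => ->; clear; lia.
by rewrite run_rcons rw /= row_insert_bump.
Qed.

(** * Permutations and pairs of ballot sequences *)

Lemma size_one_line n (s : 'S_n) : size (one_line s) = n.
Proof. by rewrite size_map size_enum_ord. Qed.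

Lemma uniq_one_line n (s : 'S_n) : uniq (one_line s).
Proof. by rewrite map_inj_uniq ?enum_uniq // => i j [] /val_inj /perm_inj. Qed.

Lemma perm_one_line n (s : 'S_n) : perm_eq (one_line s) (iota 1 n).
Proof.
apply: uniq_perm (uniq_one_line s) (iota_uniq 1 n) _.
have [z||//] := uniq_min_size (uniq_one_line s) (s2 := iota 1 n).
  by case/mapP => i _ ->; rewrite mem_iota add1n /= ltnS.
by rewrite size_iota size_one_line.
Qed.

Lemma one_line_inj n : injective (@one_line n).
Proof.
move=> s t /eq_in_map e; apply/permP => i.
by have [] := e i (mem_enum 'I_n i) => /val_inj.
Qed.

Lemma one_line_surj n (w : seq nat) : perm_eq w (iota 1 n) ->
  exists s : 'S_n, one_line s = w.
Proof.
move=> pw; have sz : size w = n by rewrite (perm_size pw) size_iota.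
have uw : uniq w by rewrite (perm_uniq pw) iota_uniq.
have wi (i : 'I_n) : 0 < nth 0 w i <= n.
  have : nth 0 w i \in w by apply: mem_nth; rewrite sz.
  by rewrite (perm_mem pw) mem_iota; lia.
have bd (i : 'I_n) : (nth 0 w i).-1 < n by have := wi i; lia.
have fi : injective (fun i => Ordinal (bd i)).
  move=> i j [] e; have {e} : nth 0 w i = nth 0 w j by have := wi i; have := wi j; lia.
  by move/eqP; rewrite nth_uniq ?sz // => /eqP /val_inj.
exists (perm fi); apply: (@eq_from_nth _ 0); rewrite size_one_line // => i lt_in.
rewrite /one_line (nth_map (Ordinal lt_in)) ?size_enum_ord // permE /= nth_enum_ord //.
by have := wi (Ordinal lt_in) => /=; lia.
Qed.

(** * Exchanging positions and letters *)

Lemma sorted_enum_ord n (c : seq 'I_n) :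
  subseq c (enum 'I_n) = sorted ltn [seq val i | i <- c].
Proof.
apply/idP/idP => [/(map_subseq val)|sc].
  by rewrite val_enum_ord => h; apply: (subseq_sorted ltn_trans h); apply: iota_ltn_sorted.
suff -> : c = [seq i <- enum 'I_n | i \in c] by apply: filter_subseq.
apply: (inj_map val_inj); apply: sorted_ltn_eq => //.
  apply: (subseq_sorted ltn_trans (map_subseq _ (filter_subseq _ _))).
  by rewrite val_enum_ord iota_ltn_sorted.
by apply: eq_mem_map => i; rewrite mem_filter mem_enum andbT.
Qed.

(* The letters of s lying in the rectangle [1, i] x [1, j]; inversion transposes it. *)
Definition rect n (s : 'S_n) (i j : nat) : seq nat :=
  [seq (val (s c)).+1 | c : 'I_n <- enum 'I_n & (c < i) && (s c < j)].

Lemma uniq_rect n (s : 'S_n) i j : uniq (rect s i j).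
Proof.
rewrite map_inj_uniq => [|a b [] /val_inj /perm_inj //].
exact/filter_uniq/enum_uniq.
Qed.

Lemma sorted_succ (c : seq nat) : sorted ltn [seq x.+1 | x <- c] = sorted ltn c.
Proof. by rewrite sorted_map; apply: eq_sorted => x y. Qed.

(** An increasing subsequence is a set of points increasing in both coordinates, so exchanging
    position and letter turns it into one of the inverse. *)
Lemma rect_chain n (s : 'S_n) i j v : subseq v (rect s i j) -> sorted ltn v ->
  exists v', [/\ subseq v' (rect s^-1%g j i), sorted ltn v' & size v' = size v].
Proof.
case/subseqP => m _ ->; rewrite -map_mask.
set c := mask m _; have sc : subseq c [seq c : 'I_n <- enum 'I_n | (c < i) && (s c < j)].
  exact: mask_subseq.
have cE : sorted ltn [seq val i | i <- c].
  by rewrite -sorted_enum_ord (subseq_trans sc) ?filter_subseq.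
rewrite (map_comp (fun x => x.+1) (fun i => val (s i))) sorted_succ => cS.
exists [seq (val i).+1 | i <- c]; split; rewrite ?size_map //; last first.
  by rewrite (map_comp (fun x => x.+1)) sorted_succ.
have -> : [seq (val i).+1 | i <- c] = [seq (val (s^-1%g i)).+1 | i <- [seq s i | i <- c]].
  by rewrite -map_comp; apply: eq_map => k /=; rewrite permK.
apply: map_subseq; rewrite subseq_filter sorted_enum_ord -map_comp cS andbT.
apply/allP => _ /mapP[k kc ->]; rewrite permK.
by have := mem_subseq sc kc; rewrite mem_filter andbC => /andP[_]; rewrite andbC.
Qed.

Lemma size_toprow_rect n (s : 'S_n) i j :
  size (toprow (rect s^-1%g j i)) = size (toprow (rect s i j)).
Proof.
have le (t : 'S_n) a b : size (toprow (rect t a b)) <= size (toprow (rect t^-1%g b a)).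
  have [v [v1 v2 <-]] := chain_eq_toprow (uniq_rect t a b).
  have [v' [v'1 v'2 <-]] := rect_chain v1 v2.
  exact: chain_le_toprow (uniq_rect _ _ _) v'1 v'2.
by apply/eqP; rewrite eqn_leq le -{2}(invgK s) le.
Qed.

Lemma rect_take n (s : 'S_n) m : m <= n -> rect s m n = take m (one_line s).
Proof.
move=> mn; rewrite /rect -map_take; congr (map _ _); apply: (inj_map val_inj).
rewrite map_take val_enum_ord take_iota (minn_idPl mn).
rewrite (eq_filter (a2 := preim val (ltn^~ m))); last by move=> i /=; rewrite ltn_ord andbT.
by rewrite -filter_map val_enum_ord (@filter_iota_ltn 0 n m).
Qed.

Lemma rect_filter n (s : 'S_n) m : rect s n m = [seq z <- one_line s | z <= m].
Proof.
rewrite /rect /one_line filter_map; congr (map _ _); apply: eq_filter => i /=.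
by rewrite ltn_ord.
Qed.

(** Inversion exchanges the two tableaux: both sides record at which [k] the first row of the first
    [k] letters of [s] grows. *)
Lemma top_bits_inv n (s : 'S_n) : top_bits (toprow (one_line s^-1%g)) n = bits (one_line s).
Proof.
suff gen m : m <= n -> top_bits (toprow (one_line s^-1%g)) m = bits (take m (one_line s)).
  by rewrite gen // take_oversize ?size_one_line.
elim: m => [|m IH] mn; first by rewrite take0.
have {}IH := IH (ltnW mn).
have sz : m < size (one_line s) by rewrite size_one_line.
(* Keeping the letters at most [k] of the inverse transposes to keeping the first [k] positions of
   [s], and transposed rectangles have first rows of equal length. *)
have cnt k : k <= n ->
    count (leq^~ k) (toprow (one_line s^-1%g)) = size (toprow (take k (one_line s))).
  by move=> kn; rewrite -rect_take // -size_toprow_rect rect_filter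
    (toprow_filter _ (uniq_one_line _)) size_filter.
have ur : uniq (toprow (one_line s^-1%g)).
  exact: sorted_uniq ltn_trans ltnn _ (toprow_sorted (uniq_one_line _)).
have := count_leqS m ur; rewrite !cnt // ?(ltnW mn) // (take_nth 0 sz) /= IH.
have ut : uniq (take m.+1 (one_line s)) by rewrite take_uniq ?uniq_one_line.
rewrite (take_nth 0 sz) in ut.
case: (runP ut) => [_|a y b -> _ _ _]; rewrite ?size_rcons ?size_cat /=.
  by case: (_ \in _) => //; lia.
by case: (_ \in _) => //; lia.
Qed.

(** Positions of the pattern become letters and conversely; the three points stay decreasing but are
    met in the opposite order. *)
Lemma has321_inv n (s : 'S_n) : has321 (one_line s^-1%g) -> has321 (one_line s).
Proof.
case=> z [y [x [/subseqP[m _ +] yz xy]]]; rewrite -map_mask.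
have : subseq (mask m (enum 'I_n)) (enum 'I_n) by apply: mask_subseq.
case: (mask m _) => [|a [|b [|c [|]]]] // sub [ez ey ex]; subst z y x.
move: sub; rewrite sorted_enum_ord /= => /and3P[ab bc _].
exists c.+1, b.+1, a.+1; split=> //.
have -> : [:: (val c).+1; (val b).+1; (val a).+1] =
    [seq (val (s i)).+1 | i <- [:: s^-1 c; s^-1 b; s^-1 a]]%g by rewrite /= !permKV.
by apply: map_subseq; rewrite sorted_enum_ord /=; apply/and3P; split.
Qed.

Definition two_row_perm n k (s : 'S_n) :=
  (longest_inc (one_line s) == k) && two_row n (sh s).

Lemma two_row_permE n k (s : 'S_n) : two_row_perm k s =
  (size (toprow (one_line s)) == k) && sorted ltn (bumps (one_line s)).
Proof.
rewrite /two_row_perm (longest_inc_toprow (uniq_one_line s)) /sh RS_tabs.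
by rewrite -(two_row_tabs (uniq_one_line s)) size_one_line.
Qed.

(** The first code is the recording tableau. By [top_bits_inv] the second is [top_bits] of the first
    row of [s], and its ballot property is domination. *)
Lemma two_row_perm_bits n k (s : 'S_n) : two_row_perm k s ->
  (bits (one_line s) \in ballots n k) /\ (bits (one_line s^-1%g) \in ballots n k).
Proof.
rewrite two_row_permE => /andP[/eqP sz st]; have us := uniq_one_line s.
split; rewrite mem_ballots.
  have [-> _] := count_bits (one_line s).
  by rewrite size_bits size_one_line ballot_bits // sz !eqxx.
rewrite -top_bits_inv invgK size_top_bits eqxx /=.
have ru := perm_trans (perm_run us) (perm_one_line s).
rewrite (proj2 (ballot_dominates ru) (run_dominates us st)) /=.
have [-> _] := count_top_bits ru (leqnn n); rewrite count_all_leq ?sz //.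
apply/allP => z zr; have := mem_iota 1 n z; rewrite -(perm_mem ru) mem_cat zr; lia.
Qed.

Lemma two_row_perm_inv n k (s : 'S_n) : two_row_perm k s -> two_row_perm k s^-1%g.
Proof.
rewrite !two_row_permE => /andP[/eqP sz st]; apply/andP; split.
  have := size_toprow_rect s n n.
  by rewrite !rect_take // !take_oversize ?size_one_line // sz => ->.
apply: avoid_sorted (uniq_one_line _) _ => /has321_inv.
exact: sorted_avoid (uniq_one_line _) st.
Qed.

Lemma top_bits_eq r r' n : sorted ltn r -> sorted ltn r' ->
  all (fun z => 0 < z <= n) r -> all (fun z => 0 < z <= n) r' ->
  top_bits r n = top_bits r' n -> r = r'.
Proof.
move=> sr sr' ar ar' e; apply: sorted_ltn_eq => // z.
case: (boolP (0 < z <= n)) => zn; last first.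
  by apply/idP/idP => [/(allP ar)|/(allP ar')] zn'; rewrite zn' in zn.
elim: n e zn {ar ar'} => [|n IH] /=; first by lia.
move=> [e /IH h]; case: (z =P n.+1) => [-> //|nz zn]; apply: h; lia.
Qed.

(** The bits of the inverses fix the first rows, hence their complements, which are the increasing
    second rows; then [run_inj] applies. *)
Lemma bits_inj n k (s t : 'S_n) : two_row_perm k s -> two_row_perm k t ->
  bits (one_line s) = bits (one_line t) -> bits (one_line s^-1%g) = bits (one_line t^-1%g) ->
  s = t.
Proof.
rewrite !two_row_permE => /andP[_ ss] /andP[_ st] e1.
rewrite -!top_bits_inv !invgK => e2.
have us := uniq_one_line s; have ut := uniq_one_line t.
have rus := perm_trans (perm_run us) (perm_one_line s).
have rut := perm_trans (perm_run ut) (perm_one_line t).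
have bd (w : 'S_n) z : z \in toprow (one_line w) -> 0 < z <= n.
  have ruw := perm_trans (perm_run (uniq_one_line w)) (perm_one_line w).
  by move=> zr; have := mem_iota 1 n z; rewrite -(perm_mem ruw) mem_cat zr; lia.
have er : toprow (one_line s) = toprow (one_line t).
  by apply: top_bits_eq e2; rewrite ?toprow_sorted //; apply/allP => z; apply: bd.
apply/one_line_inj/run_inj => //; rewrite !runE er e1; congr (_, _, _).
apply: sorted_ltn_eq => // z.
have := perm_mem (perm_trans rus (etrans (perm_sym _ _) rut)) z.
rewrite er !mem_cat; case: (boolP (z \in toprow _)) => //= zr _.
rewrite (negbTE (run_disj ut zr)); rewrite -er in zr.
by rewrite (negbTE (run_disj us zr)).
Qed.

Lemma bits_surj n k p q : p \in ballots n k -> q \in ballots n k ->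
  exists s : 'S_n, [/\ two_row_perm k s, bits (one_line s) = q & bits (one_line s^-1%g) = p].
Proof.
rewrite !mem_ballots => /and3P[/eqP sp bp /eqP cp] /and3P[/eqP sq bq /eqP cq].
have ru := perm_row_of p; rewrite sp in ru.
have srt := sorted_row_of.
have tp := top_bits_row_of p; rewrite sp in tp.
have d : dominates (row_of p) (row_of [seq ~~ b | b <- p]).
  by apply/(ballot_dominates ru); rewrite tp.
have sz1 : size (row_of p) = k.
  have [e _] := count_top_bits ru (leqnn n); rewrite tp cp count_all_leq in e => //.
  by apply/allP => z /row_of_bound; rewrite sp.
have [|||w pw rw] := run_surj (srt p) (srt [seq ~~ b | b <- p]) _ d bq.
- by rewrite (perm_uniq ru) iota_uniq.
- by rewrite sz1.
- have := perm_size ru; rewrite size_cat size_iota sz1 -{1}sq -(count_predC id q) cq.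
  by move/addnI.
have [s es] := one_line_surj (perm_trans pw ru); exists s.
rewrite two_row_permE -(top_bits_inv s^-1%g) invgK es /toprow /bumps /bits rw /= sz1 eqxx.
by rewrite srt tp.
Qed.

Lemma ell_2rowE n k : ell_2row n k = size (ballots n k) ^ 2.
Proof.
rewrite /ell_2row cardE -(size_map (fun s : 'S_n => (bits (one_line s), bits (one_line s^-1%g)))).
rewrite -mulnn -(size_allpairs pair); apply: perm_size; apply: uniq_perm.
- rewrite map_inj_in_uniq ?enum_uniq // => s t; rewrite !mem_enum !inE.
  by move=> hs ht [e1 e2]; apply: (bits_inj hs ht).
- by apply: allpairs_uniq; rewrite ?uniq_ballots // => -[? ?] [? ?] _ _ [-> ->].
move=> [q p]; apply/mapP/allpairsP => [[s]|[[q' p'] /= [hq hp [-> ->]]]].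
  rewrite mem_enum inE => /two_row_perm_bits[h1 h2] [-> ->].
  by exists (bits (one_line s), bits (one_line s^-1%g)).
have [s [hs <- <-]] := bits_surj hp hq.
by exists s; rewrite // mem_enum inE.
Qed.

Lemma inv_2rowE n k : inv_2row n k = size (ballots n k).
Proof.
rewrite /inv_2row cardE -(size_map (fun s : 'S_n => bits (one_line s))).
have invE (s : 'S_n) : (s ^+ 2 == 1)%g = (s^-1 == s)%g.
  by rewrite expgS expg1 -[in LHS](mulgV s) (can_eq (mulKg s)) eq_sym.
apply: perm_size; apply: uniq_perm.
- rewrite map_inj_in_uniq ?enum_uniq // => s t; rewrite !mem_enum !inE !invE.
  move=> /andP[/eqP is_ hs] /andP[/eqP it ht] e.
  by apply: (bits_inj hs ht); rewrite ?is_ ?it.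
- exact: uniq_ballots.
move=> q; apply/mapP/idP => [[s]|hq].
  by rewrite mem_enum inE => /andP[_ /two_row_perm_bits[h _]] ->.
(* With both codes equal to [q], the permutation and its inverse share their codes, so [bits_inj]
   identifies them. *)
have [s [hs e1 e2]] := bits_surj hq hq.
exists s; rewrite // mem_enum inE invE; apply/andP; split=> //; apply/eqP.
by apply: (bits_inj (two_row_perm_inv hs) hs); rewrite ?invgK ?e1 ?e2.
Qed.

(** * Log-concavity *)

(** Pascal's rule in both binomials. The bound includes [n = k.*2.+1], where there are no ballot
    sequences and the binomials agree, because the induction reaches this case. *)
Lemma size_ballots n k : n <= k.*2.+1 ->
  size (ballots n k) + 'C(n, k.+1) = 'C(n, k).
Proof.
elim: n k => [|n IH] k nk; first by case: k {nk}.
rewrite /=; case: ifP => le.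
  case: k nk le => [//|k] nk le.
  have e1 : n <= k.*2.+1 by lia.
  have e2 : n <= k.+1.*2.+1 by lia.
  by rewrite size_cat !size_map !binS; move: (IH _ e1) (IH _ e2) => /=; clear; lia.
have en : n.+1 - k = k.+1 by lia.
by rewrite add0n -en bin_sub //; lia.
Qed.

Lemma ballots0 n k : k.*2 < n -> size (ballots n k) = 0.
Proof. by case: n => [//|n] /=; rewrite ltnNge => /negbTE->. Qed.

(** Since (k + 1) C(n, k + 1) = (n - k) C(n, k), the factor is (k + 1) - (n - k). *)
Lemma size_ballots_mul n k : n <= k.*2.+1 -> k <= n ->
  size (ballots n k) * k.+1 = (k.*2.+1 - n) * 'C(n, k).
Proof.
move=> nk kn; rewrite -(addnK 'C(n, k.+1) (size _)) (size_ballots nk).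
rewrite mulnBl [X in _ - X]mulnC mul_bin_left [X in X - _]mulnC -mulnBl.
by congr (_ * _); lia.
Qed.

Lemma ballots_log_concave n k : 0 < k -> k < n ->
  size (ballots n k.-1) * size (ballots n k.+1) <= size (ballots n k) ^ 2.
Proof.
case: k => [//|k] _ kn.
case: (leqP n k.*2) => nk; last by rewrite ballots0.
(* After the shift of [k] the three terms sit at [k], [k.+1] and [k.+2]. Here [m] is 2k + 1 - n, so
   their factors are m, m + 2, m + 4, and [p.+2] is n - k; truncated subtraction disappears. *)
have [m ml] : {m | n + m.+2 = k.*2.+3} by exists (k.*2.+1 - n); lia.
have [p pk] : {p | n = k + p.+2} by exists (n - k.+2); lia.
have e0 : size (ballots n k) * k.+1 = m * 'C(n, k).
  by rewrite size_ballots_mul; [congr (_ * _)|..]; lia.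
have e1 : size (ballots n k.+1) * k.+2 = m.+2 * 'C(n, k.+1).
  by rewrite size_ballots_mul; [congr (_ * _)|..]; lia.
have e2 : size (ballots n k.+2) * k.+3 = m.+4 * 'C(n, k.+2).
  by rewrite size_ballots_mul; [congr (_ * _)|..]; lia.
have b0 : k.+1 * 'C(n, k.+1) = p.+2 * 'C(n, k) by rewrite mul_bin_left pk addKn.
have b1 : k.+2 * 'C(n, k.+2) = p.+1 * 'C(n, k.+1).
  by rewrite mul_bin_left; congr (_ * _); lia.
rewrite [k.+1.-1]/=.
move: (size (ballots n k)) (size (ballots n k.+1)) (size (ballots n k.+2)) e0 e1 e2.
move: 'C(n, k) 'C(n, k.+1) 'C(n, k.+2) b0 b1 => A B D b0 b1 x y z e0 e1 e2.
clear nk kn ml pk.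
have xB : x * p.+2 = m * B.
  apply/eqP; rewrite -(eqn_pmul2r (ltn0Sn k)); apply/eqP.
  by rewrite mulnAC e0 -!mulnA (mulnC A) -b0 (mulnC B).
have zB : z * (k.+3 * k.+2) = m.+4 * p.+1 * B.
  by rewrite mulnA e2 -!mulnA (mulnC D) b1.
(* The multiplier clears all denominators. With everything written through [B], what remains is m (m
   + 4) <= (m + 2)^2 and (p + 1)(k + 2) <= (p + 2)(k + 3). *)
have pos : 0 < p.+2 * k.+3 * k.+2 * k.+2 by rewrite !muln_gt0.
rewrite -(leq_pmul2r pos).
have -> : x * z * (p.+2 * k.+3 * k.+2 * k.+2) = (x * p.+2) * (z * (k.+3 * k.+2)) * k.+2 by ring.
have -> : y ^ 2 * (p.+2 * k.+3 * k.+2 * k.+2) = (y * k.+2) ^ 2 * (p.+2 * k.+3) by ring.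
rewrite xB zB e1.
have -> : m * B * (m.+4 * p.+1 * B) * k.+2 = B ^ 2 * ((m * m.+4) * (p.+1 * k.+2)) by ring.
have -> : (m.+2 * B) ^ 2 * (p.+2 * k.+3) = B ^ 2 * (m.+2 ^ 2 * (p.+2 * k.+3)) by ring.
rewrite leq_mul2l; apply/orP; right; apply: leq_mul; last by apply: leq_mul.
have -> : m.+2 ^ 2 = m * m.+4 + 4 by ring.
exact: leq_addr.
Qed.

Local Open Scope ring_scope.

Theorem theorem3p2 (R : realFieldType) (n : nat) (hn : (1 <= n)%N) :
  log_concave n (fun k => (ell_2row n k)%:R : R) /\
  log_concave n (fun k => (inv_2row n k)%:R : R).
Proof.
have lc k : (1 <= k <= n)%N -> k.-1 = 0%N \/ k = n \/
    (size (ballots n k.-1) * size (ballots n k.+1) <= size (ballots n k) ^ 2)%N.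
  move=> /andP[k0 kn]; move: kn; rewrite leq_eqVlt => /orP[/eqP|kn]; first by auto.
  by right; right; apply: ballots_log_concave.
split=> k hk; rewrite /pad0 hk; move: hk (lc k hk) => /andP[k0 kn] [e|[e|le]].
all: try by rewrite e /= mul0r sqr_ge0.
all: try by rewrite e ltnn andbF mulr0 sqr_ge0.
all: case: ifP => _; last by rewrite mul0r sqr_ge0.
all: case: ifP => _; last by rewrite mulr0 sqr_ge0.
all: rewrite ?ell_2rowE ?inv_2rowE -natrM -natrX ler_nat //.
(* The first sequence consists of squares of ballot numbers, so its inequality is the square of
   theirs. *)
by rewrite -expnMn leq_exp2r.
Qed.
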